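(* Let $\xi:\mathbb Z^k\to\mathbb R$ be a monomorphism and let $\epsilon>0$. Then there is a $\xi$-regular family $\Gamma=\{\xi_1,\dots,\xi_k\}$ of homomorphisms $\mathbb Z^k\to\mathbb Z$ such that $d(l(\xi),l(\xi_i))<\epsilon$ for every $i$.
   Context: A family $\{\xi_1,\dots,\xi_k\}$ of homomorphisms $\mathbb Z^k\to\mathbb Z$ is $\xi$-regular if (1) $(\xi_1,\dots,\xi_k)$ is a basis of the free abelian group $\mathrm{Hom}(\mathbb Z^k,\mathbb Z)$, and (2) all the coordinates of $\xi$ (viewed in $\mathrm{Hom}(\mathbb Z^k,\mathbb R)$) in the basis $(\xi_1,\dots,\xi_k)$ are strictly positive. Homomorphisms $\mathbb Z^k\to\mathbb R$ are identified with linear forms on $\mathbb R^k$, hence (using a $\mathbb Z$-basis of $\mathbb Z^k$) with vectors of the Euclidean space $\mathbb R^k$. For a non-zero vector $v$, $l(v)=\{tv: t\geq0\}$ is the ray generated by $v$. For two rays $l_1,l_2$, $d(l_1,l_2)$ is the angular distance: the distance, in the induced Riemannian metric of the unit sphere $S$ centered at $0$, between the points $l_1\cap S$ and $l_2\cap S$. *)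

(* Defs.v *)
From HB Require Import structures.
From mathcomp Require Import all_boot all_order all_algebra.
From mathcomp Require Import all_classical all_reals all_analysis.

Set Implicit Arguments.
Unset Strict Implicit.
Unset Printing Implicit Defensive.

Import Order.TTheory GRing.Theory Num.Theory.
Import numFieldNormedType.Exports.

Local Open Scope classical_set_scope.
Local Open Scope ring_scope.

(* Z^k is 'rV[int]_k, and its group homomorphisms are additive maps. *)

Definition is_Zbasis (k : nat) (b : 'I_k -> 'rV[int]_k) : Prop :=
  forall x : 'rV[int]_k, exists! c : 'rV[int]_k, x = \sum_i c 0 i *: b i.

(* Equality in Hom(Z^k, Z) is spelled out pointwise: MathComp puts no group
   structure on {additive _ -> _}. *)
Definition is_hom_basis (k : nat) (g : 'I_k -> {additive 'rV[int]_k -> int}) :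
    Prop :=
  forall f : {additive 'rV[int]_k -> int},
    exists! c : 'rV[int]_k, forall x, f x = \sum_i c 0 i * g i x.

Definition hom_to_real (R : realType) (k : nat) (f : 'rV[int]_k -> int) :
    'rV[int]_k -> R :=
  fun x => (f x)%:~R.

Definition coordinates_in (R : realType) (k : nat) (xi : 'rV[int]_k -> R)
    (g : 'I_k -> {additive 'rV[int]_k -> int}) (c : 'rV[R]_k) : Prop :=
  forall x, xi x = \sum_i c 0 i * hom_to_real R (g i) x.

(* The coordinates exist and are unique as soon as g is a basis of Hom(Z^k, Z),
   so the existential below only names them. *)
Definition regular_family (R : realType) (k : nat) (xi : 'rV[int]_k -> R)
    (g : 'I_k -> {additive 'rV[int]_k -> int}) : Prop :=
  is_hom_basis g /\
  exists c : 'rV[R]_k, coordinates_in xi g c /\ forall i, 0 < c 0 i.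

(* The linear form on R^k extending f, as a vector, when R^k is identified with
   Z^k (x) R through the basis b. *)
Definition hom_vector (R : realType) (k : nat) (b : 'I_k -> 'rV[int]_k)
    (f : 'rV[int]_k -> R) : 'rV[R]_k :=
  \row_i f (b i).

(* The library norm on 'rV[R]_k is the sup norm, hence this definition. *)
Definition euclidean_norm (R : realType) (k : nat) (v : 'rV[R]_k) : R :=
  Num.sqrt (\sum_i v 0 i ^+ 2).

Definition unit_sphere (R : realType) (k : nat) : set 'rV[R]_k :=
  [set v | euclidean_norm v = 1].

Definition ray (R : realType) (k : nat) (v : 'rV[R]_k) : set 'rV[R]_k :=
  [set t *: v | t in [set t : R | 0 <= t]].

(* c is the restriction to [a, b] of a C^1 curve defined on the whole line;
   this is one-sided differentiability at a and b. *)
Definition C1_on (R : realType) (k : nat) (a b : R) (c : R -> 'rV[R]_k) : Prop :=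
  exists c1 : R -> 'rV[R]_k,
    [/\ forall t, derivable c1 t 1,
        continuous (derive1 c1) &
        forall t, a <= t <= b -> c t = c1 t].

(* 0 :: s is a subdivision 0 = t_0 < t_1 < ... < t_n = 1. *)
Definition piecewise_C1 (R : realType) (k : nat) (c : R -> 'rV[R]_k) : Prop :=
  exists s : seq R,
    [/\ path (fun x y => x < y) 0 s, last 0 s = 1 &
        forall i, (i < size s)%N ->
          C1_on (nth 0 (0 :: s) i) (nth 0 (0 :: s) i.+1) c].

(* The derivative takes an irrelevant value at the finitely many break points. *)
Definition curve_length (R : realType) (k : nat) (c : R -> 'rV[R]_k) : \bar R :=
  (\int[lebesgue_measure]_(t in `[0%R, 1%R]) (euclidean_norm (derive1 c t))%:E)%E.

Definition spherical_curve (R : realType) (k : nat) (u v : 'rV[R]_k)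
    (c : R -> 'rV[R]_k) : Prop :=
  [/\ piecewise_C1 c, forall t, 0 <= t <= 1 -> @unit_sphere R k (c t),
      c 0 = u & c 1 = v].

(* Distance of the Riemannian metric induced on the unit sphere by R^k; it is
   +oo when no curve joins u to v (the two points of the sphere of R^1). *)
Definition sphere_dist (R : realType) (k : nat) (u v : 'rV[R]_k) : \bar R :=
  ereal_inf [set curve_length c | c in spherical_curve u v].

(* For the ray of a non-zero vector the intersection is a single point, which
   xget selects. *)
Definition ray_point (R : realType) (k : nat) (l : set 'rV[R]_k) : 'rV[R]_k :=
  xget 0 (l `&` @unit_sphere R k).

Definition angular_dist (R : realType) (k : nat) (l1 l2 : set 'rV[R]_k) :
    \bar R :=
  sphere_dist (ray_point l1) (ray_point l2).

(* Main.v *)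
Require Import Defs.
From HB Require Import structures.
From mathcomp Require Import all_boot all_order all_algebra.
From mathcomp Require Import all_classical all_reals all_analysis.
From mathcomp Require Import ring lra.

Set Implicit Arguments.
Unset Strict Implicit.
Unset Printing Implicit Defensive.

Import Order.TTheory GRing.Theory Num.Theory.
Import numFieldNormedType.Exports.

Local Open Scope classical_set_scope.
Local Open Scope ring_scope.

(* In the coordinates of b, xi is a vector w whose entries are linearly
   independent over Z, and we look for a unimodular cone of integer vectors that
   contains w in its interior and is close to the direction of w.  The vectors v
   with |v - t w| <= d t for some t >= 0 form a convex cone around w.  It contains
   k independent integer vectors spanning a simplicial cone around w: take vectors
   at bounded distance from N w with N large.  If the determinant of these vectors
   is not a unit, some integer vector is a combination u = sum_j t_j v_j with
   0 <= t_j < 1 not all zero; replacing v_m by u, where m minimizes c_j / t_j for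
   w = sum_j c_j v_j, keeps w in the cone and multiplies the determinant by
   t_m < 1.  By independence w never lies on a face, so the descent ends at a
   unimodular cone.  The angular distance is bounded by the length of an arc of a
   great circle. *)

(** * Great circles *)

Definition dot (R : realType) (k : nat) (u v : 'rV[R]_k) : R :=
  \sum_i u 0 i * v 0 i.

Section Dot.
Variables (R : realType) (k : nat).
Implicit Types u v w : 'rV[R]_k.

Lemma dotC u v : dot u v = dot v u.
Proof. by apply: eq_bigr => i _; rewrite mulrC. Qed.

Lemma dotDl u v w : dot (u + v) w = dot u w + dot v w.
Proof. by rewrite -big_split; apply: eq_bigr => i _; rewrite mxE mulrDl. Qed.

Lemma dotZl a u v : dot (a *: u) v = a * dot u v.
Proof. by rewrite big_distrr; apply: eq_bigr => i _; rewrite mxE /= mulrA. Qed.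

Lemma dotDr u v w : dot u (v + w) = dot u v + dot u w.
Proof. by rewrite ![dot u _]dotC dotDl. Qed.

Lemma dotZr a u v : dot u (a *: v) = a * dot u v.
Proof. by rewrite ![dot u _]dotC dotZl. Qed.

Lemma dot_ge0 u : 0 <= dot u u.
Proof. by apply: sumr_ge0 => i _; rewrite -expr2 sqr_ge0. Qed.

Lemma dot_gt0 u : u != 0 -> 0 < dot u u.
Proof.
move=> u0; rewrite lt_neqAle dot_ge0 andbT; apply: contraNneq u0 => /esym /eqP.
rewrite psumr_eq0 => [/allP h|i _]; last by rewrite -expr2 sqr_ge0.
apply/eqP/rowP => i; rewrite mxE.
by have := h i (mem_index_enum _); rewrite /= mulf_eq0 orbb => /eqP.
Qed.

Lemma euclidean_normE u : euclidean_norm u = Num.sqrt (dot u u).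
Proof. by congr Num.sqrt; apply: eq_bigr => i _; rewrite expr2. Qed.

Lemma unit_sphereE u : @unit_sphere R k u <-> dot u u = 1.
Proof.
rewrite /unit_sphere /= euclidean_normE; split=> [h|->]; last by rewrite sqrtr1.
by rewrite -(sqr_sqrtr (dot_ge0 u)) h expr1n.
Qed.

Lemma ray_pointE u : u != 0 -> ray_point (ray u) = (euclidean_norm u)^-1 *: u.
Proof.
move=> u0; have uu := dot_gt0 u0.
have n0 : 0 < euclidean_norm u by rewrite euclidean_normE sqrtr_gt0.
have nn : dot u u = euclidean_norm u ^+ 2.
  by rewrite euclidean_normE sqr_sqrtr // ltW.
apply: xget_unique => [|v [[t /= t0 <-]]].
  split; first by exists (euclidean_norm u)^-1 => //=; rewrite invr_ge0 ltW.
  by apply/unit_sphereE; rewrite dotZl dotZr nn; field; rewrite gt_eqF.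
move/unit_sphereE; rewrite dotZl dotZr nn => h; congr (_ *: _).
have : (t * euclidean_norm u) ^+ 2 = 1 ^+ 2 by rewrite expr1n -h; ring.
move/eqP; rewrite eqrXn2 ?mulr_ge0 ?ler01 // ?(ltW n0) // => /eqP e.
by apply: (mulIf (lt0r_neq0 n0)); rewrite e mulVf // gt_eqF.
Qed.

(** For orthonormal [u] and [v], this is the great circle leaving [u] towards [v], run at constant
    speed [a], so that time 1 corresponds to an arc of length [a]. *)
Definition circle_arc (a : R) u v (t : R) : 'rV[R]_k :=
  cos (a * t) *: u + sin (a * t) *: v.

Lemma is_derive_circle_arc (a : R) u v (t : R) :
  is_derive t (1 : R) (circle_arc a u v) (a *: circle_arc a v (- u) t).
Proof.
have D i j : is_derive t (1 : R) (fun t => circle_arc a u v t i j)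
    ((a *: circle_arc a v (- u) t) i j).
  rewrite (_ : (fun _ => _) = (fun t => cos (a * t) * u i j + sin (a * t) * v i j)).
    have Ha : is_derive t (1 : R) (fun t : R => a * t) a.
      by rewrite -[X in is_derive _ _ _ X]mulr1; exact: is_deriveZ.
    have Hc := is_derive1_comp (is_derive_cos (a * t)) Ha.
    have Hs := is_derive1_comp (is_derive_sin (a * t)) Ha.
    apply: is_derive_eq.
    by rewrite !mxE /GRing.scale /=; ring.
  by apply/funext => s; rewrite !mxE.
have df : derivable (circle_arc a u v) t (1 : R).
  by apply/derivable_mxP => i j; have [] := D i j.
split => //; rewrite derive_mx //; apply/matrixP => i j; rewrite mxE.
by have [] := D i j.
Qed.

Lemma derive1_circle_arc a u v :
  derive1 (circle_arc a u v) = (fun t => a *: circle_arc a v (- u) t).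
Proof.
by apply/funext => t; rewrite derive1E; have [] := is_derive_circle_arc a u v t.
Qed.

Lemma continuous_circle_arc a u v : continuous (circle_arc a u v).
Proof.
move=> t; have [d _] := is_derive_circle_arc a u v t.
exact/differentiable_continuous/derivable1_diffP.
Qed.

(* The case [a = 0] allows the constant arc, for which [v] may be any vector:
   in dimension 1 no unit vector is orthogonal to [u]. *)
Lemma sphere_dist_circle_arc a u v : 0 <= a -> dot u u = 1 -> dot u v = 0 ->
  (a != 0 -> dot v v = 1) ->
  (sphere_dist u (circle_arc a u v 1) <= a%:E)%E.
Proof.
move=> a0 uu uv vv; apply: ereal_inf_lbound; exists (circle_arc a u v).
  split.
  - exists [:: 1]; split => //=; first by rewrite ltr01.
    case=> // _ /=; exists (circle_arc a u v); split => // [t|].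
      by have [] := is_derive_circle_arc a u v t.
    rewrite derive1_circle_arc => t.
    by apply: cvgZr; exact: continuous_circle_arc.
  - move=> t _; apply/unit_sphereE; rewrite /circle_arc.
    rewrite !(dotDl, dotDr, dotZl, dotZr) uu uv (dotC v u) uv.
    have [->|/vv ->] := eqVneq a 0.
      by rewrite mul0r cos0 sin0 !(mul0r, mulr0, addr0, mulr1).
    by rewrite -[RHS](cos2Dsin2 (a * t)); ring.
  - by rewrite /circle_arc mulr0 cos0 sin0 scale1r scale0r addr0.
  - by [].
rewrite /curve_length derive1_circle_arc.
under eq_integral => t _.
  rewrite (_ : euclidean_norm _ = a); first over.
  rewrite euclidean_normE dotZl dotZr.
  have [->|/[dup] an0 /vv vv1] := eqVneq a 0; first by rewrite mul0r sqrtr0.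
  rewrite (_ : a * _ = a ^+ 2) ?sqrtr_sqr ?ger0_norm //.
  rewrite /circle_arc -scaleN1r !(dotDl, dotDr, dotZl, dotZr) vv1.
  by rewrite uu uv (dotC v u) uv -[RHS]mulr1 -[in RHS](cos2Dsin2 (a * t)); ring.
rewrite integral_cst //= lebesgue_measure_itv /= lte_fin ltr01.
by rewrite sube0 mule1.
Qed.

(** The great circle arc from [u] to [v] has length [acos (dot u v)], and cosine decreases on
    [[0, pi]], so this length is below [eps]. *)
Lemma sphere_dist_lt u v eps : 0 < eps <= pi -> dot u u = 1 -> dot v v = 1 ->
  cos eps < dot u v -> (sphere_dist u v < eps%:E)%E.
Proof.
move=> /andP[e0 epi] uu vv cuv; set d := dot u v in cuv.
have dv1 : -1 <= d <= 1.
  have := dot_ge0 (u - v); have := dot_ge0 (u + v).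
  rewrite -scaleN1r !(dotDl, dotDr, dotZl, dotZr) uu vv (dotC v u) -/d => *.
  by apply/andP; split; lra.
set a := acos d.
have ca : cos a = d by rewrite acosK // in_itv.
have sa : sin a = Num.sqrt (1 - d ^+ 2) by rewrite sin_acos.
have a0 : 0 <= a by rewrite acos_ge0.
have ae : a < eps.
  rewrite -ltr_cos ?ca // in_itv /= ?a0 ?acos_lepi // ltW //.
apply: (@le_lt_trans _ _ a%:E); last by rewrite lte_fin.
(* Normalized component of [v] orthogonal to [u]. If [sin a = 0], the inverse convention makes [p]
   zero and [v = d *: u]; since [a < eps <= pi], this happens only for [a = 0], where the arc is
   constant. *)
pose p := (sin a)^-1 *: (v - d *: u).
have sa2 : dot (v - d *: u) (v - d *: u) = sin a ^+ 2.
  rewrite sin2cos2 ca -scaleNr !(dotDl, dotDr, dotZl, dotZr) uu vv (dotC v u) -/d.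
  by ring.
have san : sin a != 0 -> dot p p = 1.
  by move=> s0; rewrite dotZl dotZr sa2; field.
have -> : v = circle_arc a u p 1.
  rewrite /circle_arc mulr1 ca /p scalerA.
  have [s0|s0] := eqVneq (sin a) 0; last first.
    by rewrite mulfV // scale1r addrC subrK.
  rewrite s0 mul0r scale0r addr0; apply/eqP; rewrite -subr_eq0.
  by apply/negPn/negP => /dot_gt0; rewrite sa2 s0 expr0n ltxx.
apply: sphere_dist_circle_arc => //.
  by rewrite dotZr -scaleNr dotDr dotZr uu -/d mulr1 addrN mulr0.
move=> an0; apply: san; rewrite gt_eqF // sin_gt0_pi //.
rewrite lt_neqAle eq_sym an0 a0 /=; exact: lt_le_trans epi.
Qed.

End Dot.

(** * Unimodular refinement of a simplicial cone *)

Local Notation realmx R := (map_mx (intr : int -> R)).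

Lemma col_mulmx (S : pzSemiRingType) (m n p : nat) (A : 'M[S]_(m, n))
    (B : 'M[S]_(n, p)) i :
  col i (A *m B) = A *m col i B.
Proof. by rewrite !colE mulmxA. Qed.

Section Refinement.
Variables (R : realType) (k : nat).
Implicit Types (w c : 'rV[R]_k) (V : 'M[int]_k).

Definition int_independent w :=
  forall n : 'cV[int]_k, w *m realmx R n = 0 -> n = 0.

(** Multiplying [w] by column [i] of the adjugate gives [c 0 i * \det V]. If this vanishes, the
    column is an integral relation on [w], hence zero, although [V] sends it to [\det V] times a
    basis vector. So [w] never lies on a face of the cone. *)
Lemma coef_neq0 w c V : int_independent w -> \det V != 0 ->
  w = c *m realmx R V -> forall i, c 0 i != 0.
Proof.
move=> indep dV wE i; apply/negP => /eqP ci0; case/negP: dV.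
have adj0 : col i (\adj V) = 0.
  apply: indep; rewrite map_col map_mx_adj -col_mulmx wE -mulmxA mul_mx_adj.
  by rewrite mul_mx_scalar; apply/colP => p; rewrite !mxE ord1 ci0 mulr0.
have /colP/(_ i) : col i (V *m \adj V) = 0 by rewrite col_mulmx adj0 mulmx0.
by rewrite mul_mx_adj !mxE eqxx mulr1n => ->.
Qed.

(** Laplace expansion along row [m]: its cofactors ignore that row, so they are those of [A]. *)
Lemma det_replace_row (S : comNzRingType) (A B : 'M[S]_k) (m : 'I_k) :
  (forall i, i != m -> row i B = row i A) ->
  \det B = (row m B *m \adj A) 0 m.
Proof.
move=> h; rewrite (expand_det_row B m) mxE; apply: eq_bigr => j _.
rewrite !mxE; congr (_ * (_ * \det _)); apply/matrixP => p q; rewrite !mxE.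
have im : lift m p != m by rewrite eq_sym neq_lift.
have /rowP/(_ (lift j q)) := h _ im; by rewrite !mxE.
Qed.

(** An integral real inverse would invert [V] over the integers. A nonintegral entry in row [i]
    shows that the [i]-th standard vector is outside the lattice spanned by the rows of [V]. *)
Lemma nonintegral_invmx V : \det V != 0 -> V \notin unitmx ->
  exists i j, forall z : int, invmx (realmx R V) i j != z%:~R.
Proof.
move=> dV nV; have rV : realmx R V \in unitmx.
  by rewrite unitmxE det_map_mx unitfE intr_eq0.
apply: contrapT => h; case/negP: nV.
have {}h i j : exists z : int, invmx (realmx R V) i j = z%:~R.
  apply: contrapT => hz; apply: h; exists i, j => z.
  by apply/eqP => e; apply: hz; exists z.
pose A := \matrix_(i, j) xget 0 [set z : int | invmx (realmx R V) i j = z%:~R].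
have AE : realmx R A = invmx (realmx R V).
  by apply/matrixP => i j; rewrite !mxE; case: xgetP => [z _ <- //|no];
     have [z hz] := h i j; case: (no z).
suff : V *m A = 1%:M by case/mulmx1_unit.
apply/matrixP => i j; apply: (@intr_inj R).
have /matrixP/(_ i j) : realmx R (V *m A) = realmx R 1%:M.
  by rewrite map_mxM AE mulmxV // map_mx1.
by rewrite mxE [RHS]mxE.
Qed.

Definition cone_closed (P : 'rV[R]_k -> Prop) :=
  [/\ P 0, forall u v, P u -> P v -> P (u + v) &
      forall a u, 0 <= a -> P u -> P (a *: u)].

Lemma cone_closed_mulmx P V c : cone_closed P -> (forall i, 0 <= c 0 i) ->
  (forall i, P (row i (realmx R V))) -> P (c *m realmx R V).
Proof.
move=> [P0 PD PZ] c0 PV; rewrite mulmx_sum_row.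
by elim/big_ind: _ => // i _; exact: PZ.
Qed.

Lemma cone_step w V c (P : 'rV[R]_k -> Prop) :
  int_independent w -> cone_closed P -> \det V != 0 -> V \notin unitmx ->
  w = c *m realmx R V -> (forall i, 0 < c 0 i) ->
  (forall i, P (row i (realmx R V))) ->
  exists V' c', [/\ \det V' != 0, (`|\det V'| < `|\det V|)%N,
    w = c' *m realmx R V', forall i, 0 < c' 0 i &
    forall i, P (row i (realmx R V'))].
Proof.
move=> indep Pcone dV nV wE c_gt0 PV.
have [i0 [j0 nonint]] := nonintegral_invmx dV nV.
have rV : realmx R V \in unitmx.
  by rewrite unitmxE det_map_mx unitfE intr_eq0.
(* [a] holds the coordinates of the standard vector [i0] in the rows of [V]. Subtracting the lattice
   vector with the floors as coordinates leaves [u], whose coordinates are the fractional parts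
   [t]. *)
pose a := row i0 (invmx (realmx R V)).
pose t : 'rV[R]_k := \row_j (a 0 j - (Num.floor (a 0 j))%:~R).
pose u : 'rV[int]_k := delta_mx 0 i0 - (\row_j Num.floor (a 0 j)) *m V.
have uE : realmx R u = t *m realmx R V.
  have -> : t = a - realmx R (\row_j Num.floor (a 0 j)).
    by apply/rowP => j; rewrite !mxE.
  rewrite mulmxBl -row_mul mulVmx // row1 map_mxB map_mxM; congr (_ - _).
  by rewrite map_delta_mx.
have t_ge0 j : 0 <= t 0 j by rewrite mxE subr_ge0 floor_le.
have t_lt1 j : t 0 j < 1.
  by rewrite mxE ltrBlDl -[1]/(1%:~R) -intrD floorD1_gt.
have tj0 : 0 < t 0 j0.
  by rewrite lt_neqAle t_ge0 andbT eq_sym !mxE subr_eq0.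
clearbody t u.
have [m tm mmin] : exists2 m, 0 < t 0 m &
    forall j, 0 < t 0 j -> c 0 m / t 0 m <= c 0 j / t 0 j.
  by case: (@arg_minP _ _ _ j0 (fun j => 0 < t 0 j) (fun j => c 0 j / t 0 j) tj0)
     => m; exists m.
pose V' : 'M[int]_k := \matrix_(i, j) if i == m then u 0 j else V i j.
have rowm : row m V' = u by apply/rowP => j; rewrite !mxE eqxx.
have rowNm i : i != m -> row i V' = row i V.
  by move=> im; apply/rowP => j; rewrite !mxE (negbTE im).
(* Cramer's rule for the coordinate [m] of [u]. *)
have detE : (\det V')%:~R = t 0 m * (\det V)%:~R :> R.
  rewrite (det_replace_row rowNm) rowm.
  have : realmx R (u *m \adj V) = \det (realmx R V) *: t.
    by rewrite map_mxM uE map_mx_adj -mulmxA mul_mx_adj mul_mx_scalar.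
  by move=> /rowP/(_ m); rewrite [LHS]mxE [RHS]mxE det_map_mx mulrC.
have dV' : \det V' != 0.
  by rewrite -(intr_eq0 R) detE mulf_neq0 ?intr_eq0 // gt_eqF.
pose c' : 'rV[R]_k :=
  \row_i if i == m then c 0 m / t 0 m else c 0 i - t 0 i * (c 0 m / t 0 m).
have wE' : w = c' *m realmx R V'.
  (* Trading [r] times [u] against the old rows cancels the coefficient of row [m]. *)
  set r := c 0 m / t 0 m in c' *.
  have -> : w = (c - r *: t) *m realmx R V + r *: realmx R u.
    by rewrite uE mulmxBl -scalemxAl -wE subrK.
  apply/rowP => j; rewrite !mxE [LHS]addrC [RHS](bigD1 m) //= [in LHS](bigD1 m) //=.
  rewrite !mxE eqxx (_ : c 0 m - r * t 0 m = 0) ?mul0r ?add0r; last first.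
    by rewrite divfK ?subrr // gt_eqF.
  congr (_ + _); apply: eq_bigr => i /negbTE im.
  by rewrite !mxE im [t 0 i * _]mulrC.
exists V', c'; split => //.
- rewrite -ltz_nat -(ltr_int R) !abszE !intr_norm detE normrM.
  rewrite (ger0_norm (ltW tm)) gtr_pMl ?t_lt1 // normr_gt0 intr_eq0 //.
(* The choice of [m] gives only nonnegative coefficients; independence of [w] makes them strictly
   positive. *)
- move=> i; rewrite lt_neqAle eq_sym (coef_neq0 indep dV' wE') /= mxE.
  case: eqP => _; first by rewrite divr_ge0 ?ltW.
  rewrite subr_ge0; have [ti|] := ltP 0 (t 0 i).
    by rewrite mulrC -ler_pdivlMr // mmin.
  move=> ti; have -> : t 0 i = 0 by apply/le_anti; rewrite ti t_ge0.
  by rewrite mul0r ltW.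
- move=> i; rewrite -map_row; have [->|im] := eqVneq i m.
    by rewrite rowm uE; exact: cone_closed_mulmx.
  by rewrite rowNm // map_row.
Qed.

Lemma unimodular_refinement w V c (P : 'rV[R]_k -> Prop) :
  int_independent w -> cone_closed P -> \det V != 0 ->
  w = c *m realmx R V -> (forall i, 0 < c 0 i) ->
  (forall i, P (row i (realmx R V))) ->
  exists V' c', [/\ V' \in unitmx,
    w = c' *m realmx R V', forall i, 0 < c' 0 i &
    forall i, P (row i (realmx R V'))].
Proof.
move=> indep Pcone; have [n] := ubnP `|\det V|%N.
elim: n V c => // n IHn V c ltn dV wE c_gt0 PV.
have [uV|nV] := boolP (V \in unitmx); first by exists V, c.
have [V' [c' [dV' lt' wE' c'_gt0 PV']]] := cone_step indep Pcone dV nV wE c_gt0 PV.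
by apply: (IHn V' c'); rewrite // -ltnS; apply: leq_trans ltn.
Qed.

End Refinement.

(** * Cones close to a given direction *)

Section Thin.
Variables (R : realType) (k : nat).
Implicit Types (w v : 'rV[R]_k).

(** The norm is the sup norm, suited to entrywise integer approximation; [dot_le_norm] links it to
    the Euclidean one. *)
Definition thin_cone (d : R) w v :=
  exists2 t : R, 0 <= t & `|v - t *: w| <= d * t.

Lemma thin_cone_closed d w : cone_closed (thin_cone d w).
Proof.
split.
- by exists 0 => //; rewrite scale0r subrr normr0 mulr0.
- move=> u v [s s0 us] [t t0 vt]; exists (s + t); first exact: addr_ge0.
  rewrite scalerDl mulrDr opprD addrACA.
  exact: le_trans (ler_normD _ _) (lerD us vt).
- move=> a u a0 [t t0 ut]; exists (a * t); first exact: mulr_ge0.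
  rewrite -scalerA -scalerBr normrZ ger0_norm // mulrCA.
  exact: ler_wpM2l.
Qed.

Lemma dot_le_norm v : dot v v <= k%:R * `|v| ^+ 2.
Proof.
have -> : k%:R * `|v| ^+ 2 = \sum_(i < k) `|v| ^+ 2.
  by rewrite sumr_const card_ord mulr_natl.
apply: ler_sum => i _.
rewrite -expr2 -real_normK ?num_real // lerXn2r ?nnegrE //.
by rewrite [leRHS]/Num.Def.normr/= mx_normrE (le_bigmax _ _ (0, i)).
Qed.

(** Write [v = t *: w + e] with [e] small, [a = dot w e], [E = dot e e], [q = 1 - kappa ^+ 2]. The
    difference of the squares of the two sides is [a ^+ 2] plus [W * (q * (t ^+ 2 * W + 2 * (t * a))
    - kappa ^+ 2 * E)], and the second term is positive once [E] is small against [t ^+ 2 * W]. *)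
Lemma thin_cone_dot w (kappa : R) : w != 0 -> 0 <= kappa < 1 ->
  exists2 d : R, 0 < d & forall v, v != 0 -> thin_cone d w v ->
    kappa * (euclidean_norm w * euclidean_norm v) < dot w v.
Proof.
move=> w0 /andP[k0 k1]; have W0 := dot_gt0 w0; set W := dot w w in W0.
set q := 1 - kappa ^+ 2; have q0 : 0 < q by rewrite /q; nra.
(* The bound [16^-1] yields [t * a >= - t ^+ 2 * W / 4]; the bound [q / 4] keeps [kappa ^+ 2 * E]
   below half of the remaining main term [q / 2 * (t ^+ 2 * W)]. *)
pose eta := Num.min (16^-1) (q / 4).
have eta0 : 0 < eta by rewrite lt_min; apply/andP; split; lra.
have eta1 : eta <= 16^-1 by rewrite ge_min lexx.
have eta2 : eta <= q / 4 by rewrite ge_min lexx orbT.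
clearbody eta.
have K0 : 0 < k.+1%:R :> R by rewrite ltr0n.
pose d := Num.sqrt (eta * W / k.+1%:R).
have d0 : 0 < d by rewrite sqrtr_gt0 divr_gt0 // mulr_gt0.
exists d => // v v0 [t t0 vt].
have tgt0 : 0 < t.
  rewrite lt_neqAle t0 andbT; apply: contraNneq v0 => t00.
  by move: vt; rewrite -t00 scale0r subr0 mulr0 normr_le0.
pose e := v - t *: w; set E := dot e e; set a := dot w e.
have vE : v = t *: w + e by rewrite addrC subrK.
move: vt; rewrite -/e => et; clearbody e.
have E0 : 0 <= E := dot_ge0 e.
have EW : E <= eta * W * t ^+ 2.
  apply: le_trans (dot_le_norm _) _.
  apply: (@le_trans _ _ (k.+1%:R * (d * t) ^+ 2)).
    by rewrite ler_pM ?ler_nat // ?lerXn2r ?nnegrE ?mulr_ge0 // ltW.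
  rewrite exprMn sqr_sqrtr; last by rewrite ltW // divr_gt0 // mulr_gt0.
  by rewrite le_eqVlt; apply/orP; left; apply/eqP; field; rewrite gt_eqF.
have wv : dot w v = t * W + a by rewrite vE dotDr dotZr.
have vv : dot v v = t ^+ 2 * W + 2 * (t * a) + E.
  by rewrite vE !(dotDl, dotDr, dotZl, dotZr) (dotC e w) -/W -/a -/E; ring.
(* Positivity of |e + t w / 4|^2 and |e - t w / 4|^2 bounds [t * a] on both sides. *)
have := dot_ge0 (4%:R^-1 * t *: w + e); have := dot_ge0 (- (4%:R^-1 * t) *: w + e).
rewrite !(dotDl, dotDr, dotZl, dotZr) (dotC e w) -/W -/a -/E => h1 h2.
have T0 : 0 < t ^+ 2 * W by rewrite mulr_gt0 // exprn_gt0.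
have eT : eta * W * t ^+ 2 <= 16^-1 * (t ^+ 2 * W) by nra.
have eT2 : eta * W * t ^+ 2 <= q / 4 * (t ^+ 2 * W) by nra.
have ta : - (t ^+ 2 * W) / 4 <= t * a by nra.
have pos : 0 < t * W + a.
  rewrite -(pmulr_rgt0 _ tgt0); nra.
rewrite wv !euclidean_normE -sqrtrM ?dot_ge0 // -/W vv.
rewrite -[ltLHS]ger0_norm ?mulr_ge0 ?sqrtr_ge0 // -[ltRHS]ger0_norm ?(ltW pos) //.
rewrite -ltr_sqr ?nnegrE ?normr_ge0 // !real_normK ?num_real // exprMn.
rewrite sqr_sqrtr; last by rewrite -vv mulr_ge0 ?dot_ge0 // ltW.
set kk := kappa ^+ 2 in q q0 eta2 eT2 *.
have kk0 : 0 <= kk by rewrite sqr_ge0.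
have kkE : kk * E <= q / 4 * (t ^+ 2 * W).
  by apply: le_trans eT2; apply: le_trans EW; rewrite /q in q0; nra.
have qT : q * (t ^+ 2 * W + 2 * (t * a)) >= q / 2 * (t ^+ 2 * W) by nra.
have qpos : 0 < q * (t ^+ 2 * W) by exact: mulr_gt0.
have main : 0 < W * (q * (t ^+ 2 * W + 2 * (t * a)) - kk * E).
  by apply: mulr_gt0 => //; lra.
rewrite -subr_gt0; apply: lt_le_trans main _; rewrite -subr_ge0.
suff -> : (t * W + a) ^+ 2 - kk * (W * (t ^+ 2 * W + 2 * (t * a) + E)) -
  W * (q * (t ^+ 2 * W + 2 * (t * a)) - kk * E) = a ^+ 2 by rewrite sqr_ge0.
by rewrite /q; ring.
Qed.

Lemma thin_cone_angle w (eps : R) : w != 0 -> 0 < eps ->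
  exists2 d : R, 0 < d & forall v, v != 0 -> thin_cone d w v ->
    (angular_dist (ray w) (ray v) < eps%:E)%E.
Proof.
move=> w0 eps0; pose e := Num.min eps (pi / 2).
have pi0 : 0 < pi :> R := pi_gt0 R.
have e0 : 0 < e by rewrite lt_min eps0 divr_gt0.
have epi : e <= pi / 2 by rewrite ge_min lexx orbT.
have ce : 0 <= cos e < 1.
  rewrite cos_ge0_pihalf /=; last by apply/andP; split; lra.
  by rewrite -[ltRHS]cos0 ltr_cos // in_itv /=; apply/andP; split; lra.
have [d d0 H] := thin_cone_dot w0 ce; exists d => // v v0 /(H _ v0) {}H.
have unit (u : 'rV[R]_k) : u != 0 -> 0 < euclidean_norm u /\
    dot ((euclidean_norm u)^-1 *: u) ((euclidean_norm u)^-1 *: u) = 1.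
  move=> u0; have n0 : 0 < euclidean_norm u.
    by rewrite euclidean_normE sqrtr_gt0 dot_gt0.
  split=> //; rewrite dotZl dotZr -[dot u u]sqr_sqrtr ?dot_ge0 //.
  by rewrite -euclidean_normE; field; rewrite gt_eqF.
have [nw uw] := unit w w0; have [nv uv] := unit v v0.
rewrite /angular_dist !ray_pointE //.
apply: (@lt_le_trans _ _ e%:E); last by rewrite lee_fin ge_min lexx.
apply: sphere_dist_lt => //; first by apply/andP; split=> //; lra.
by rewrite dotZl dotZr mulrA -invfM mulrC ltr_pdivlMr ?mulr_gt0.
Qed.

End Thin.

Section Start.
Variables (R : realType) (k : nat).

(* The rows s_j (v_j + K delta_ij) surround N w when s is the sign vector of w, v is
   the integer part of N |w| and K > k. *)
Definition initial_mx (S : comNzRingType) (K : S) (s v : 'rV[S]_k) : 'M[S]_k :=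
  \matrix_(i, j) (s 0 j * (v 0 j + K *+ (i == j))).

Lemma mul_initial_mx (S : comNzRingType) (K : S) (s v x : 'rV[S]_k) j :
  (x *m initial_mx K s v) 0 j = s 0 j * (v 0 j * \sum_i x 0 i + K * x 0 j).
Proof.
rewrite !mxE; under eq_bigr do rewrite mxE mulrCA mulrDr.
rewrite -big_distrr /= big_split /= -big_distrl /= mulrC mulrC [v 0 j * _]mulrC.
congr (_ * (_ + _)); rewrite (bigD1 j) //= eqxx mulr1n big1 ?addr0 1?mulrC //.
by move=> i /negbTE ->; rewrite mulr0n mulr0.
Qed.

Lemma det_initial_mx (K : int) (s v : 'rV[int]_k) : 0 < K ->
  (forall j, s 0 j != 0) -> (forall j, 0 <= v 0 j) ->
  \det (initial_mx K s v) != 0.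
Proof.
move=> K0 s0 v0; apply/det0P => -[x x0 xV]; case/negP: x0.
set X := \sum_i x 0 i.
have e j : K * x 0 j = - (v 0 j * X).
  have /rowP/(_ j)/eqP := xV; rewrite mul_initial_mx mxE mulf_eq0.
  by rewrite (negbTE (s0 j)) /= addr_eq0 => /eqP ->; rewrite opprK.
have X0 : X = 0.
  have : (K + \sum_j v 0 j) * X = 0.
    rewrite mulrDl /X big_distrr /= (eq_bigr _ (fun j _ => e j)) sumrN.
    by rewrite -big_distrl addNr.
  move/eqP; rewrite mulf_eq0 gt_eqF /= => [/eqP //|].
  by rewrite ltr_wpDr // sumr_ge0.
apply/eqP/rowP => j; move: (e j); rewrite X0 mulr0 oppr0 mxE => /eqP.
by rewrite mulf_eq0 gt_eqF // => /eqP.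
Qed.

Lemma initial_cone (w : 'rV[R]_k) (d : R) : (forall j, w 0 j != 0) -> 0 < d ->
  exists V c, [/\ \det V != 0, w = c *m realmx R V,
    forall i, 0 < c 0 i & forall i, thin_cone d w (row i (realmx R V))].
Proof.
move=> w0 d0; pose K : int := k.+1.
pose N : R := (Num.bound (k.+2%:R / d))%:R.
have NK : k.+2%:R <= d * N.
  by rewrite mulrC -ler_pdivrMr // ltW // archi_boundP // divr_ge0 // ltW.
have N0 : 0 < N by rewrite -(pmulr_rgt0 _ d0); apply: lt_le_trans NK.
pose s : 'rV[int]_k := \row_j sgz (w 0 j).
pose v : 'rV[int]_k := \row_j Num.floor (N * `|w 0 j|).
have sw j : (s 0 j)%:~R * `|w 0 j| = w 0 j.
  by rewrite mxE -sgrEz mulr_sg_norm.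
have s1 j : `|(s 0 j)%:~R| = 1 :> R.
  by rewrite mxE -sgrEz normr_sg w0.
have v0 j : 0 <= v 0 j by rewrite mxE floor_ge0 mulr_ge0 // ltW.
have vle j : (v 0 j)%:~R <= N * `|w 0 j| by rewrite mxE floor_le.
have vgt j : N * `|w 0 j| < (v 0 j)%:~R + 1.
  by rewrite mxE -[1]/(1%:~R) -intrD floorD1_gt.
clearbody s v.
have rE : realmx R (initial_mx K s v) =
    initial_mx k.+1%:R (realmx R s) (realmx R v).
  by apply/matrixP => i j; rewrite !mxE intrM intrD; case: eqP.
have K1 : k.+1%:R != 0 :> R by rewrite pnatr_eq0.
pose D : R := k.+1%:R + \sum_j (v 0 j)%:~R.
have D0 : 0 < D by rewrite ltr_wpDr // sumr_ge0 // => j _; rewrite ler0z.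
pose S := (\sum_j `|w 0 j|) / D.
have SN : S * N < 1.
  rewrite mulrAC ltr_pdivrMr // mul1r mulrC big_distrr /=.
  apply: (@le_lt_trans _ _ (\sum_j ((v 0 j)%:~R + 1))).
    by apply: ler_sum => j _; exact: ltW.
  by rewrite big_split /= sumr_const card_ord addrC ltrD2r ltr_nat.
pose c : 'rV[R]_k := \row_j ((`|w 0 j| - S * (v 0 j)%:~R) / k.+1%:R).
have cS : \sum_j c 0 j = S.
  under eq_bigr do rewrite mxE.
  rewrite -big_distrl /= big_split /= sumrN -big_distrr /=.
  have -> : \sum_j `|w 0 j| = S * D by rewrite divfK // gt_eqF.
  by rewrite /D; move: (k.+1%:R : R) K1 => q q0; field.
exists (initial_mx K s v), c; split.
- apply: det_initial_mx => // j; apply/eqP => sj.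
  by move: (s1 j); rewrite sj normr0 => /esym/eqP; rewrite oner_eq0.
- apply/rowP => j; rewrite rE mul_initial_mx cS !mxE -[LHS]sw.
  by congr (_ * _); move: (k.+1%:R : R) K1 => q q0; field.
- move=> j; rewrite mxE divr_gt0 // subr_gt0.
  have w1 : 0 < `|w 0 j| by rewrite normr_gt0.
  have S0 : 0 <= S by rewrite divr_ge0 ?sumr_ge0 ?ltW.
  apply: (@le_lt_trans _ _ (S * (N * `|w 0 j|))); first exact: ler_wpM2l.
  by rewrite mulrA gtr_pMl.
- move=> i; exists N; first exact: ltW.
  apply: le_trans NK; rewrite [leLHS]/Num.Def.normr /= mx_normrE.
  apply: bigmax_le => // -[p j] _; rewrite (ord1 p) rE !mxE /=.
  rewrite -[w 0 j]sw mulrCA -mulrBr normrM s1 mul1r.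
  have := vle j; have := vgt j.
  have kpos : 0 <= k.+1%:R :> R by rewrite ler0n.
  rewrite -[k.+2%:R]natr1; case: (i == j) => /= ? ?;
    rewrite ?mulr1n ?mulr0n ler_norml; apply/andP; split; lra.
Qed.

End Start.

(** * Families of homomorphisms *)

Section Homs.
Variables (k : nat) (b : 'I_k -> 'rV[int]_k).

Lemma additive_lin_comb (M : zmodType) (f : {additive 'rV[int]_k -> M})
    (c : 'rV[int]_k) : f (\sum_i c 0 i *: b i) = \sum_i f (b i) *~ c 0 i.
Proof.
rewrite raddf_sum; apply: eq_bigr => i _.
by rewrite -[c 0 i in LHS]intz scaler_int raddfMz.
Qed.

Definition form (u : 'cV[int]_k) (x : 'rV[int]_k) : int := (x *m u) 0 0.

Lemma form_additive u : zmod_morphism (form u).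
Proof. by move=> x y; rewrite /form mulmxBl !mxE. Qed.

HB.instance Definition _ u :=
  GRing.isZmodMorphism.Build 'rV[int]_k int (form u) (form_additive u).

Lemma Zbasis_coords : is_Zbasis b -> exists C : 'M[int]_k,
  (forall x : 'rV_k, x = \sum_i (x *m C) 0 i *: b i) /\
  (forall j, b j *m C = delta_mx 0 j).
Proof.
move=> hb; pose B := \matrix_i b i.
have sumE (y : 'rV[int]_k) : \sum_i y 0 i *: b i = y *m B.
  by rewrite mulmx_sum_row; apply: eq_bigr => i _; rewrite rowK.
have /choice[c cP] : forall i : 'I_k, exists c : 'rV[int]_k, delta_mx 0 i = c *m B.
  by move=> i; have [c [e _]] := hb (delta_mx 0 i); exists c; rewrite -sumE.
pose C := \matrix_i c i.
have CB : C *m B = 1%:M.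
  by apply/row_matrixP => i; rewrite row_mul rowK -cP row1.
exists C; split=> [x|j]; first by rewrite sumE -mulmxA CB mulmx1.
by rewrite -(rowK b j) -row_mul (mulmx1C CB) row1.
Qed.

Lemma row_neq0_mulmx1 (S : nzRingType) (V V' : 'M[S]_k) i :
  V *m V' = 1%:M -> row i V != 0.
Proof.
move=> VV; apply: contra_neq (oner_neq0 S) => r0.
have /rowP/(_ i) : row i (V *m V') = 0 by rewrite row_mul r0 mul0mx.
by rewrite VV !mxE eqxx.
Qed.

Definition dual_family (C V : 'M[int]_k) (i : 'I_k) :
  {additive 'rV[int]_k -> int} := form (C *m (row i V)^T).

Lemma dual_familyE C V i x : dual_family C V i x = \sum_j (x *m C) 0 j * V i j.
Proof.
by rewrite /dual_family /= /form mulmxA mxE; apply: eq_bigr => j _; rewrite !mxE.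
Qed.

Lemma dual_family_basis C V : (forall x : 'rV_k, x = \sum_i (x *m C) 0 i *: b i) ->
  (forall j, b j *m C = delta_mx 0 j) -> V \in unitmx ->
  is_hom_basis (dual_family C V).
Proof.
move=> bC Cb uV f; pose F := \row_j f (b j).
have fP (c : 'rV_k) : (forall x, f x = \sum_i c 0 i * dual_family C V i x) <->
    F = c *m V.
  have dE x : \sum_i c 0 i * dual_family C V i x =
      \sum_j (x *m C) 0 j * (c *m V) 0 j.
    under eq_bigr do rewrite dual_familyE big_distrr.
    rewrite exchange_big /=; apply: eq_bigr => j _.
    rewrite [(c *m V) 0 j]mxE big_distrr /=; apply: eq_bigr => i _.
    by rewrite mulrCA.
  split=> [h|e x].
    apply/rowP => j; rewrite mxE h dE Cb (bigD1 j) //= big1 ?addr0.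
      by rewrite mxE !eqxx mul1r.
    by move=> i ij; rewrite mxE (negbTE ij) andbF mul0r.
  rewrite [in LHS](bC x) additive_lin_comb dE -e; apply: eq_bigr => j _.
  by rewrite [F 0 j]mxE -mulrzl intz.
exists (F *m invmx V); split; first by apply/fP; rewrite mulmxKV.
by move=> c /fP ->; rewrite mulmxK.
Qed.

End Homs.

Theorem theorem3p2 (R : realType) (k : nat) (b : 'I_k -> 'rV[int]_k)
    (hb : is_Zbasis b) (xi : {additive 'rV[int]_k -> R})
    (hxi : injective xi) (eps : R) (heps : 0 < eps) :
  exists g : 'I_k -> {additive 'rV[int]_k -> int},
    regular_family xi g /\
    forall i : 'I_k,
      (angular_dist (ray (hom_vector b xi))
                    (ray (hom_vector b (hom_to_real R (g i)))) < eps%:E)%E.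
Proof.
have [C [bC Cb]] := Zbasis_coords hb.
set w := hom_vector b xi.
have indep : int_independent w.
  move=> n wn; have sn : \sum_i n^T 0 i *: b i = 0.
    apply: hxi; rewrite additive_lin_comb raddf0.
    have /matrixP/(_ 0 0) := wn; rewrite !mxE => e; rewrite -[RHS]e.
    by apply: eq_bigr => i _; rewrite !mxE -mulrzr.
  have [c [_ cU]] := hb 0.
  have c0 : c = 0.
    by apply: cU; rewrite big1 // => i _; rewrite mxE scale0r.
  by apply: trmx_inj; rewrite trmx0 -c0; apply/esym/cU; rewrite sn.
have w_neq0 j : w 0 j != 0.
  apply/negP => /eqP wj0.
  have /colP/(_ j) : delta_mx j 0 = 0 :> 'cV[int]_k.
    apply: indep; rewrite map_delta_mx -colE; apply/matrixP => p q.
    by rewrite mxE (ord1 p) wj0 mxE.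
  by rewrite !mxE !eqxx.
have [d d0 close] : exists2 d : R, 0 < d & forall (i : 'I_k) v, v != 0 ->
    thin_cone d w v -> (angular_dist (ray w) (ray v) < eps%:E)%E.
  (* The case w = 0 occurs only for k = 0. *)
  have [w0|w0] := eqVneq w 0.
    by exists 1 => // i; have := w_neq0 i; rewrite w0 mxE eqxx.
  by have [d d0 dP] := thin_cone_angle w0 heps; exists d.
have [V0 [c0 [dV0 wE0 c0_gt0 thin0]]] := initial_cone w_neq0 d0.
have [V [c [uV wE c_gt0 thinV]]] :=
  unimodular_refinement indep (thin_cone_closed d w) dV0 wE0 c0_gt0 thin0.
exists (dual_family C V); split; first split.
- exact: dual_family_basis bC Cb uV.
- exists c; split=> // x; rewrite [in LHS](bC x) additive_lin_comb.
  rewrite /hom_to_real; under [RHS]eq_bigr do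
    rewrite dual_familyE rmorph_sum big_distrr.
  rewrite exchange_big /=; apply: eq_bigr => j _.
  have /rowP/(_ j) := wE; rewrite mxE => ->.
  rewrite mxE -mulrzr big_distrl /=; apply: eq_bigr => i _.
  by rewrite mxE rmorphM /= -mulrA [_ * (V i j)%:~R]mulrC.
- move=> i; have -> : hom_vector b (hom_to_real R (dual_family C V i)) =
      row i (realmx R V).
    apply/rowP => j; rewrite !mxE /hom_to_real dual_familyE Cb (bigD1 j) //= big1.
      by rewrite mxE !eqxx mul1r addr0.
    by move=> m mj; rewrite mxE (negbTE mj) andbF mul0r.
  apply: close => //; apply: (@row_neq0_mulmx1 _ _ _ (map_mx intr (invmx V))).
  by rewrite -map_mxM mulmxV // map_mx1.
Qed.
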